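(* Let $n \geq 3$ be an integer and let $k$ be a positive divisor of $n$ with $k \neq n$ (so that $\frac{n}{k} \geq 2$). Then the simultaneous Diophantine system \[ x_{1}^\mu+ x_{2}^\mu+ \cdots +x_{n}^\mu=k \cdot \left(y_{1}^\mu+ y_{2}^\mu + \cdots + y_{n/k}^\mu \right), \qquad \mu=1 \text{ and } \mu=3, \] in the unknowns $x_1,\dots,x_n,y_1,\dots,y_{n/k}$, has infinitely many nontrivial parametric solutions in nonzero integers.
   Context: A solution is a tuple $(x_1,\dots,x_n,y_1,\dots,y_{n/k})$ satisfying both equations (for $\mu=1$ and $\mu=3$) simultaneously. ''Nontrivial'' means that for all indices $i \neq j$ one has $x_i \neq \pm x_j$ and $y_i \neq \pm y_j$, and for all $i,j$ one has $x_i \neq \pm y_j$. A parametric solution is a family of solutions whose entries are given by integer polynomials in integer parameters. *)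

(* Defs.v *)
From HB Require Import structures.
From mathcomp Require Import all_boot all_order all_algebra.
From mathcomp Require Import mpoly.

Set Implicit Arguments.
Unset Strict Implicit.
Unset Printing Implicit Defensive.

Import GRing.Theory.
Local Open Scope ring_scope.

Record point (n m : nat) (T : Type) := Point {
  px : 'I_n -> T;
  py : 'I_m -> T
}.

Definition coord n m T (s : point n m T) (a : 'I_n + 'I_m) : T :=
  match a with inl i => px s i | inr j => py s j end.

Definition power_eq n m (k mu : nat) (s : point n m int) : Prop :=
  \sum_(i < n) px s i ^+ mu = k%:R * \sum_(j < m) py s j ^+ mu.

Definition solution n m (k : nat) (s : point n m int) : Prop :=
  power_eq k 1 s /\ power_eq k 3 s.

Definition nontrivial n m (s : point n m int) : Prop :=
  [/\ forall i i', i <> i' -> px s i <> px s i' /\ px s i <> - px s i',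
      forall j j', j <> j' -> py s j <> py s j' /\ py s j <> - py s j'
    & forall i j, px s i <> py s j /\ px s i <> - py s j].

Definition nonzero n m (s : point n m int) : Prop :=
  (forall i, px s i <> 0) /\ (forall j, py s j <> 0).

(* Vanishing of all 2x2 minors; over an integral domain, for points with
   nonzero coordinates, this is equality up to a nonzero factor from the
   fraction field. *)
Definition proportional n m (R : comNzRingType) (s t : point n m R) : Prop :=
  forall a b, coord s a * coord t b = coord s b * coord t a.

Definition specialize n m r (v : 'I_r -> int) (S : point n m {mpoly int[r]}) :
    point n m int :=
  Point (fun i => (px S i).@[v]) (fun j => (py S j).@[v]).

(* The system is homogeneous, so every single solution s yields the family
   p * s with p a polynomial.  The last clause excludes such families (and
   constant ones): the point must move projectively with the parameters. *)
Definition nontrivial_parametric_solution n m r (k : nat)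
    (S : point n m {mpoly int[r]}) : Prop :=
  (forall v : 'I_r -> int,
     [/\ solution k (specialize v S),
         nontrivial (specialize v S)
       & nonzero (specialize v S)]) /\
  (exists u v : 'I_r -> int,
     ~ proportional (specialize u S) (specialize v S)).

(* Main.v *)
(** A point is read as a weighted configuration: weight [1] on the [x_i] and
    weight [-k] on the [y_j].  Since [n = k * (n / k)] the total weight is
    zero, so once the first moment vanishes, translating the configuration by
    [s] keeps the first moment and adds [3 * s * M2] to the third moment [M3].
    The translation by [- M3 / (3 * M2)], cleared of its denominator,
    therefore turns every configuration with vanishing first moment into a
    solution.  This is applied to a fixed configuration completed by the pair
    [y_1 = t, y_2 = - t], which leaves [M1] and [M3] unchanged while
    [M2 = Q - 2 * k * t ^ 2].  If [M3 <> 0] and [t] is large, the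
    translation is nonzero but smaller than [1/2], hence coordinates that were
    distinct end up with distinct nonzero absolute values.  Taking
    [t = N + a + X ^ 2] keeps [t] large at every integer value of [X]. *)
Require Import Defs.
From mathcomp Require Import all_boot all_order all_algebra.
From mathcomp Require Import mpoly.
From mathcomp Require Import zify ring lra.

Set Implicit Arguments.
Unset Strict Implicit.
Unset Printing Implicit Defensive.

Import Order.TTheory GRing.Theory Num.Theory Defs.
Local Open Scope ring_scope.

(** * Weighted moments and the centering translation *)

Definition moment n m (R : comNzRingType) (k mu : nat) (c : 'I_n + 'I_m -> R) : R :=
  \sum_(i < n) c (inl i) ^+ mu - k%:R * \sum_(j < m) c (inr j) ^+ mu.

Definition centered n m (R : comNzRingType) (k : nat) (c : 'I_n + 'I_m -> R) :
    point n m R :=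
  let z e := 3 * moment k 2 c * c e - moment k 3 c in
  Point (fun i => z (inl i)) (fun j => z (inr j)).

Lemma coord_centered n m (R : comNzRingType) k (c : 'I_n + 'I_m -> R) e :
  coord (centered k c) e = 3 * moment k 2 c * c e - moment k 3 c.
Proof. by case: e. Qed.

Lemma rmorph_moment n m (R R' : comNzRingType) (f : {rmorphism R -> R'}) k mu
    (c : 'I_n + 'I_m -> R) c' :
  (forall e, f (c e) = c' e) -> f (moment k mu c) = moment k mu c'.
Proof.
move=> fc; rewrite /moment rmorphB rmorphM rmorph_nat !rmorph_sum.
by congr (_ - _ * _); apply: eq_bigr => i _; rewrite rmorphXn fc.
Qed.

Lemma coord_specialize_centered n m r k (v : 'I_r -> int)
    (c : 'I_n + 'I_m -> {mpoly int[r]}) c' :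
    (forall e, (c e).@[v] = c' e) ->
  coord (specialize v (centered k c)) =1 coord (centered k c').
Proof.
move=> cc' e; rewrite coord_centered -cc' -!(rmorph_moment (f := meval v) _ _ cc').
rewrite -(rmorph_nat (meval v)) -!rmorphM -rmorphB /= -coord_centered.
by case: e.
Qed.

Lemma sum_affine (R : comNzRingType) n (a b : R) (F : 'I_n -> R) :
  \sum_i (a * F i - b) = a * (\sum_i F i) - n%:R * b.
Proof. by rewrite big_split /= -mulr_sumr sumr_const card_ord mulNrn mulr_natl. Qed.

Lemma sum_affine_cube (R : comNzRingType) n (a b : R) (F : 'I_n -> R) :
  \sum_i (a * F i - b) ^+ 3 =
  a ^+ 3 * (\sum_i F i ^+ 3) - 3 * a ^+ 2 * b * (\sum_i F i ^+ 2)
  + 3 * a * b ^+ 2 * (\sum_i F i) - n%:R * b ^+ 3.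
Proof.
have -> : \sum_i (a * F i - b) ^+ 3 =
  \sum_i (a ^+ 3 * F i ^+ 3 + (- (3 * a ^+ 2 * b) * F i ^+ 2
          + (3 * a * b ^+ 2 * F i - b ^+ 3))).
  by apply: eq_bigr => i _; ring.
by rewrite !big_split /= -!mulr_sumr sumr_const card_ord mulNrn -mulr_natl; ring.
Qed.

(** With [a = 3 * M2] and [b = M3], the third moment of [a * c - b] is
    [a ^ 3 * M3 - 3 * a ^ 2 * b * M2 = 0]; the other terms vanish with the first moment and the
    total weight. *)
Lemma centered_solution m k (s : point (k * m) m int) (c : _ -> int) :
    moment k 1 c = 0 -> coord s =1 coord (centered k c) -> solution k s.
Proof.
move=> M1 sc.
have sx i : px s i = 3 * moment k 2 c * c (inl i) - moment k 3 c by exact: (sc (inl i)).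
have sy j : py s j = 3 * moment k 2 c * c (inr j) - moment k 3 c by exact: (sc (inr j)).
have {}M1 : \sum_i c (inl i) = k%:R * \sum_j c (inr j).
  exact: subr0_eq M1.
split; rewrite /power_eq.
  under eq_bigr do rewrite sx expr1.
  under [in RHS]eq_bigr do rewrite sy expr1.
  by rewrite !sum_affine M1 natrM; ring.
under eq_bigr do rewrite sx.
under [in RHS]eq_bigr do rewrite sy.
rewrite !sum_affine_cube M1 natrM /moment.
by ring.
Qed.

(** Equal coordinates force [c e = c e'] by cancellation. Opposite ones give
    [3 * M2 * (c e + c e') = 2 * M3], where the integer [c e + c e'] is zero, against [M3 != 0], or
    at least 1 in absolute value, against the size bound. The case [e = e'] of opposite coordinates
    excludes zeros. *)
Lemma centered_separated n m k (c : 'I_n + 'I_m -> int) :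
    injective c -> moment k 3 c != 0 ->
    2 * `|moment k 3 c| < 3 * `|moment k 2 c| ->
  forall e e', (e <> e' -> coord (centered k c) e <> coord (centered k c) e')
    /\ coord (centered k c) e <> - coord (centered k c) e'.
Proof.
move=> injc M3 M23 e e'; rewrite !coord_centered.
have M2 : moment k 2 c != 0 by lia.
split=> [ne eqz | eqz].
  apply: ne; apply: injc; apply: (mulfI (x := 3 * moment k 2 c)); first by lia.
  by lia.
move: M3 M23 M2 eqz; move: (moment k 3 c) (moment k 2 c) => u w M3 M23 M2 eqz.
have {}eqz : 3 * w * (c e + c e') = 2 * u by lia.
case: (eqVneq (c e + c e') 0) => [s0 | s0]; first by rewrite s0 in eqz; lia.
have : `|3 * w * (c e + c e')| = 2 * `|u| by rewrite eqz; lia.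
rewrite !normrM.
have : 1 <= `|c e + c e'| by lia.
by nia.
Qed.

Lemma centered_nontrivial n m k (s : point n m int) c :
    injective c -> moment k 3 c != 0 ->
    2 * `|moment k 3 c| < 3 * `|moment k 2 c| ->
    coord s =1 coord (centered k c) ->
  nontrivial s /\ nonzero s.
Proof.
move=> injc M3 M23 sc.
have sep e e' : (e <> e' -> coord s e <> coord s e') /\ coord s e <> - coord s e'.
  by rewrite !sc; apply: centered_separated.
have nz e : coord s e <> 0 by move=> z; case: (sep e e) => _; rewrite z oppr0.
split; last by split=> [i|j]; [apply: (nz (inl i)) | apply: (nz (inr j))].
split=> [i i' ne|j j' ne|i j].
- by have [d o] := sep (inl i) (inl i'); split=> //; apply: d => -[].
- by have [d o] := sep (inr j) (inr j'); split=> //; apply: d => -[].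
- by have [d o] := sep (inl i) (inr j); split=> //; apply: d.
Qed.

(** * The explicit configuration *)

Definition bulk (p q k : nat) : nat :=
  (\sum_(i < p) i.+1 + k * \sum_(j < q) j.+2)%N.

(** The entry [bulk] balances the first moment against the fixed values [-1, ..., -p] of the [x_i]
    and [2, ..., q + 1] of the [y_j]. *)
Definition config (p q k : nat) (R : comNzRingType) (t : R)
    (e : 'I_p.+1 + 'I_q.+2) : R :=
  match e with
  | inl i => if i == p :> nat then (bulk p q k)%:R else - (i.+1)%:R
  | inr j => if j == 0%N :> nat then t
             else if j == 1%N :> nat then - t else j%:R
  end.
Arguments config p q k {R} t e.

Lemma rmorph_config p q k (R R' : comNzRingType) (f : {rmorphism R -> R'}) t e :
  f (config p q k t e) = config p q k (f t) e.
Proof.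
case: e => [i|j] /=.
  by case: eqP => _; rewrite ?rmorphN rmorph_nat.
by do 2?case: eqP => _; rewrite ?rmorphN ?rmorph_nat.
Qed.

Lemma sum_config_inl p q k (t : int) mu :
  \sum_i config p q k t (inl i) ^+ mu =
  (\sum_(i < p) (- (i.+1)%:R) ^+ mu) + (bulk p q k)%:R ^+ mu.
Proof.
rewrite big_ord_recr /= eqxx; congr (_ + _).
by apply: eq_bigr => i _; rewrite (ltn_eqF (ltn_ord i)).
Qed.

Lemma sum_config_inr p q k (t : int) mu :
  \sum_j config p q k t (inr j) ^+ mu =
  t ^+ mu + ((- t) ^+ mu + \sum_(j < q) (j.+2)%:R ^+ mu).
Proof. by rewrite !big_ord_recl. Qed.

Lemma moment1_config p q k (t : int) : moment k 1 (config p q k t) = 0.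
Proof.
rewrite /moment sum_config_inl sum_config_inr !expr1 /bulk.
under eq_bigr do rewrite expr1.
under [in X in _ - X]eq_bigr do rewrite expr1.
rewrite sumrN natrD natrM !natr_sum; ring.
Qed.

Lemma moment2_config p q k :
  exists Q : int, forall t : int,
    moment k 2 (config p q k t) = Q - 2 * k%:R * t ^+ 2.
Proof.
eexists => t; rewrite /moment sum_config_inl sum_config_inr sqrrN.
instantiate (1 := (\sum_(i < p) (- (i.+1)%:R) ^+ 2) + (bulk p q k)%:R ^+ 2
                  - k%:R * \sum_(j < q) (j.+2)%:R ^+ 2); ring.
Qed.

Lemma sum_cube_le n (F : 'I_n -> nat) :
  (\sum_i F i ^ 3 <= (\sum_i F i) ^ 3)%N.
Proof.
elim/big_ind2: _ => // x1 x2 y1 y2 hx hy; nia.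
Qed.

Lemma sum_cube_lt p (hp : (1 < p)%N) :
  (\sum_(i < p) i.+1 ^ 3 < (\sum_(i < p) i.+1) ^ 3)%N.
Proof.
case: p hp => [//|[//|p]] _; rewrite !big_ord_recl /=.
have := sum_cube_le (fun i : 'I_p => (lift ord0 (lift ord0 i)).+1).
rewrite /bump /=; set s := (\sum_(i < p) _)%N; set s3 := (\sum_(i < p) _)%N.
by move=> h; nia.
Qed.

(** Up to sign, the fixed entries sum with weights to [bulk], and the cube of a sum of positive
    terms dominates the sum of cubes, strictly since [p > 1] provides two terms. *)
Lemma moment3_config p q k (hp : (1 < p)%N) (hk : (0 < k)%N) :
  exists2 M : int, 0 < M & forall t : int, moment k 3 (config p q k t) = M.
Proof.
exists ((bulk p q k)%:R ^+ 3 - (\sum_(i < p) (i.+1)%:R ^+ 3)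
        - k%:R * \sum_(j < q) (j.+2)%:R ^+ 3).
  have lt1 := sum_cube_lt hp.
  have le2 := sum_cube_le (fun j : 'I_q => j.+2).
  have : (\sum_(i < p) i.+1 ^ 3 + k * \sum_(j < q) j.+2 ^ 3 < bulk p q k ^ 3)%N.
    rewrite /bulk; move: lt1 le2.
    set a3 := (\sum_(i < p) i.+1 ^ 3)%N; set a := (\sum_(i < p) i.+1)%N.
    set b3 := (\sum_(j < q) j.+2 ^ 3)%N; set b := (\sum_(j < q) j.+2)%N.
    move=> lt1 le2.
    (* The weight is absorbed through [k <= k ^ 3]. *)
    have : (k * b3 <= (k * b) ^ 3)%N.
      by rewrite expnMn; apply: leq_mul le2; apply: (@leq_pexp2l k 1 3).
    move: (k * b)%N (k * b3)%N => u u3 ?; nia.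
  rewrite -(ltr_nat int) natrD natrM natrX !natr_sum => h.
  under eq_bigr do rewrite -natrX.
  under [X in _ - _ * X]eq_bigr do rewrite -natrX.
  lra.
move=> t; rewrite /moment sum_config_inl sum_config_inr.
have -> : \sum_(i < p) (- i.+1%:R) ^+ 3 = - \sum_(i < p) (i.+1%:R : int) ^+ 3.
  by rewrite -sumrN; apply: eq_bigr => i _; ring.
ring.
Qed.

Lemma leq_ord_sum n (F : 'I_n -> nat) i : (F i <= \sum_j F j)%N.
Proof. by rewrite (bigD1 i) //= leq_addr. Qed.

Lemma config_inj p q k (t : int) (hp : (1 < p)%N) (hk : (0 < k)%N) :
  (bulk p q k + q.+2 + p)%:R < t -> injective (config p q k t).
Proof.
move=> ht.
have B0 : (0 < bulk p q k)%N.
  have := leq_ord_sum (fun i : 'I_p => i.+1) (Ordinal hp).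
  by rewrite /bulk /=; lia.
(* Besides a multiple of [j], [bulk] contains a positive contribution of the [x_i]. *)
have Bj j : (1 < j < q.+2)%N -> (j < bulk p q k)%N.
  move=> /andP[j1 jq].
  have jq' : (j.-2 < q)%N by lia.
  have := leq_ord_sum (fun i : 'I_p => i.+1) (Ordinal hp).
  have := leq_ord_sum (fun j : 'I_q => j.+2) (Ordinal jq').
  by rewrite /bulk /=; nia.
have nR (x : nat) : x%:R = x :> int by rewrite natz.
case=> [i|j] [i'|j'] /=; rewrite !nR; rewrite nR in ht.
- have := ltn_ord i; have := ltn_ord i'.
  by do 2!case: eqP => ?; move=> ? ? ?; congr inl; apply: val_inj => /=; lia.
- have := ltn_ord i; have := ltn_ord j'; have := Bj j'.
  by do 3?case: eqP => ?; lia.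
- have := ltn_ord j; have := ltn_ord i'; have := Bj j.
  by do 3?case: eqP => ?; lia.
- have := ltn_ord j; have := ltn_ord j'.
  by do 4?case: eqP => ?; move=> ? ? ?; congr inr; apply: val_inj => /=; lia.
Qed.

(* Differences of coordinates are not affected by the translation, and the
   ratio (y_1 - y_2) / (x_2 - x_1) = - 2 * t is a projective invariant. *)
Lemma centered_config_not_proportional p q k (s s' : point p.+1 q.+2 int) t t' :
    (1 < p)%N ->
    moment k 2 (config p q k t) != 0 -> moment k 2 (config p q k t') != 0 ->
    coord s =1 coord (centered k (config p q k t)) ->
    coord s' =1 coord (centered k (config p q k t')) ->
  t <> t' -> ~ proportional s s'.
Proof.
move=> hp w0 w0' sc sc' ne prop; apply: ne.
have hi1 : (1 < p.+1)%N by lia.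
pose x0 : 'I_p.+1 + 'I_q.+2 := inl ord0.
pose x1 : 'I_p.+1 + 'I_q.+2 := inl (Ordinal hi1).
pose y0 : 'I_p.+1 + 'I_q.+2 := inr (Ordinal (isT : 0 < q.+2)%N).
pose y1 : 'I_p.+1 + 'I_q.+2 := inr (Ordinal (isT : 1 < q.+2)%N).
have := (prop x0 y0, prop x0 y1, prop x1 y0, prop x1 y1).
rewrite !sc !sc' !coord_centered /=.
have -> : (0%N == p) = false by lia.
have -> : (1%N == p) = false by lia.
move: w0 w0'; move: (moment _ 2 _) (moment _ 2 _) (moment _ 3 _) (moment _ 3 _).
move=> w w' u u' w0 w0' [[[e1 e2] e3] e4].
(* Combining the four minors gives the minor of the differences [x0 - x1 = 3 * w] and
   [y0 - y1 = 6 * w * t], free of [u] and [u']. *)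
have : (18 * w * w') * t = (18 * w * w') * t'.
  have : (3 * w * - 1 - u - (3 * w * - 2 - u)) * (3 * w' * t' - u' - (3 * w' * - t' - u'))
       = (3 * w * t - u - (3 * w * - t - u)) * (3 * w' * - 1 - u' - (3 * w' * - 2 - u')).
    by lia.
  by lia.
by apply: mulfI; rewrite !mulf_neq0.
Qed.

(** * The parametric family *)

Definition parametric_config (p q k N a : nat) :
    'I_p.+1 + 'I_q.+2 -> {mpoly int[1]} :=
  config p q k ((N + a)%:R + 'X_ord0 ^+ 2).
Arguments parametric_config : clear implicits.

Lemma meval_parametric_config p q k N a v e :
  (parametric_config p q k N a e).@[v] =
  config p q k ((N + a)%:R + v ord0 ^+ 2) e.
Proof.
rewrite /parametric_config (rmorph_config k (meval v)).
by rewrite rmorphD rmorphXn rmorph_nat /= mevalXU.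
Qed.

Theorem mainTheorem1 (n k : nat) (hn : (3 <= n)%N) (hk : (0 < k)%N)
    (hdvd : (k %| n)%N) (hkn : k <> n) :
  exists (r : nat) (S : nat -> point n (n %/ k) {mpoly int[r]}),
    (forall a : nat, nontrivial_parametric_solution k (S a)) /\
    (forall a b : nat, a <> b -> ~ proportional (S a) (S b)).
Proof.
have [m nE] : exists m, n = (k * m)%N by case/dvdnP: hdvd => m ->; exists m; lia.
rewrite nE mulKn // -nE.
case: m nE => [|[|q]] nE; [lia | lia |].
case: n hn hdvd hkn nE => [//|p] hp _ _ nE.
have {}hp : (1 < p)%N by lia.
have [Q hQ] := moment2_config p q k.
have [M M0 hM] := moment3_config q hp hk.
(* The first three terms serve injectivity; [Q] and [M] ensure that the second moment outweighs the
   third. *)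
pose N := (bulk p q k + q.+2 + p + `|Q| + `|M|).+1%N.
have big t : N%:R <= t :> int ->
    2 * `|moment k 3 (config p q k t)| < 3 * `|moment k 2 (config p q k t)|.
  rewrite hQ hM /N natz => ht.
  have : t <= k%:R * t ^+ 2.
    by rewrite natz; nia.
  by lia.
have w0 t : N%:R <= t :> int -> moment k 2 (config p q k t) != 0.
  by move=> /big; case: eqP => // ->; lia.
pose T a (v : 'I_1 -> int) := (N + a)%:R + v ord0 ^+ 2 : int.
have TN a v : N%:R <= T a v by rewrite /T !natz; nia.
pose S a := centered k (parametric_config p q k N a).
have SE a v : coord (specialize v (S a)) =1 coord (centered k (config p q k (T a v))).
  by apply: coord_specialize_centered => e; rewrite meval_parametric_config.
exists 1%N, S; split=> [a | a b neab prop].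
  split=> [v|].
    have [] := centered_nontrivial _ _ (big _ (TN a v)) (SE a v).
    - by apply: config_inj => //; have := TN a v; rewrite !natz /N; lia.
    - by rewrite hM; lia.
    move=> nt nz; split=> //.
    (* The point and the configuration are generalized so that [p.+1] can become [k * q.+2] in their
       types. *)
    move: (specialize v (S a)) (SE a v); move: (moment1_config p q k (T a v)).
    move: (config p q k (T a v)); rewrite nE => c c1 s; exact: centered_solution.
  exists (fun=> 0), (fun=> 1).
  apply: (centered_config_not_proportional hp _ _ (SE _ _) (SE _ _)); rewrite ?w0 //.
  by rewrite /T; lia.
(* Proportionality of polynomial points survives evaluation, so the parameter value 0 suffices to
   separate [a] from [b]. *)
have ne : T a (fun=> 0) <> T b (fun=> 0) by rewrite /T !natz; lia.
apply: (centered_config_not_proportional hp _ _ (SE _ _) (SE _ _) ne); rewrite ?w0 //.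
move=> e e'; have := congr1 (meval (fun=> 0)) (prop e e').
by rewrite !rmorphM; case: e e' => [i|i] [j|j].
Qed.
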